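(* For all integers $a,b\geq 1$, with $n=ab$, \[ \sum_{S \in \mathcal{SYT}^{+1}(a\times b)} q^{\mathrm{comaj}^{+1}(S)} = \frac{[a]_q[b]_q}{[a+b]_q} \cdot [ab+1]_q \cdot \sum_{T \in \mathcal{SYT}(a\times b)} q^{\mathrm{comaj}(T)} \] as an identity of polynomials in $q$.
   Context: For a positive integer $k$, $[k]_q=1+q+\cdots+q^{k-1}$. The $a\times b$ rectangle is the Young diagram with $a$ rows of $b$ boxes each (English notation, rows numbered from top to bottom). A standard Young tableau (SYT) of shape $a\times b$ is a filling of the $n=ab$ boxes with $1,\dots,n$, each used once, increasing along rows (left to right) and down columns; $\mathcal{SYT}(a\times b)$ is their set. A (natural) descent of $T$ is an entry $i\in\{1,\dots,n-1\}$ such that $i+1$ appears in a strictly higher row than $i$; $\mathrm{comaj}(T)=\sum_{i \text{ descent}}(n-i)$. A standard barely set-valued tableau of shape $a\times b$ is a filling of the boxes by nonempty sets of numbers such that the sets partition $\{1,\dots,n+1\}$, exactly one box $u_*(S)$ contains two numbers and all others contain one, and $\max S(u)<\min S(v)$ whenever box $u$ is weakly northwest of box $v$, $u\neq v$; $\mathcal{SYT}^{+1}(a\times b)$ is their set. Let $i_*(S)=\max S(u_*(S))$. A barely set-valued descent of $S$ is a number $i\in\{1,\dots,n+1\}$ such that $i+1\le n+1$ and $i+1$ appears in a strictly higher row than $i$, except that $i_*(S)-1$ is never a descent and $i_*(S)$ is always a descent. $\mathrm{comaj}^{+1}(S)=\sum_{i \text{ barely set-valued descent}}(n+1-i)$.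 *)

(* Defs.v *)
From mathcomp Require Import all_boot all_order all_algebra.
From mathcomp Require Export fraction.

Set Implicit Arguments.
Unset Strict Implicit.
Unset Printing Implicit Defensive.

(* Box (r, c) lies in row r and column c, both counted from 0; row 0 is the
   top row, so "strictly higher" means a strictly smaller row index. *)
Definition weakly_nw (a b : nat) (u v : 'I_a * 'I_b) : bool :=
  (u.1 <= v.1) && (u.2 <= v.2).

(* Entries are 1-based: an ordinal stands for the entry equal to its value,
   and 0 is excluded from the tableaux below.  An injective filling of the
   a * b boxes with values in {1, ..., a * b} uses each value exactly once. *)
Definition is_syt (a b : nat) (T : {ffun 'I_a * 'I_b -> 'I_(a * b).+1}) : bool :=
  [&& [forall u, 0 < T u],
      injectiveb T,
      [forall r : 'I_a, forall c : 'I_b, forall c' : 'I_b,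
         (c < c') ==> (T (r, c) < T (r, c'))]
    & [forall r : 'I_a, forall r' : 'I_a, forall c : 'I_b,
         (r < r') ==> (T (r, c) < T (r', c))]].

Definition SYT (a b : nat) : {set {ffun 'I_a * 'I_b -> 'I_(a * b).+1}} :=
  [set T | is_syt T].

Definition descent (a b : nat) (T : {ffun 'I_a * 'I_b -> 'I_(a * b).+1})
    (i : nat) : bool :=
  [exists u : 'I_a * 'I_b, exists v : 'I_a * 'I_b,
     [&& T u == i :> nat, T v == i.+1 :> nat & v.1 < u.1]].

Definition comaj (a b : nat) (T : {ffun 'I_a * 'I_b -> 'I_(a * b).+1}) : nat :=
  \sum_(1 <= i < a * b | descent T i) (a * b - i).

(* The first three clauses say that the sets S u partition {1, ..., a * b + 1};
   the last one is max (S u) < min (S v) for u weakly northwest of v. *)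
Definition is_bsvt (a b : nat)
    (S : {ffun 'I_a * 'I_b -> {set 'I_(a * b).+2}}) : bool :=
  [&& [forall u, S u != set0],
      [forall u, forall v, (u != v) ==> [disjoint S u & S v]],
      \bigcup_u S u == [set i : 'I_(a * b).+2 | 0 < i],
      [exists u, (#|S u| == 2) && [forall v, (v != u) ==> (#|S v| == 1)]]
    & [forall u, forall v, (weakly_nw u v && (u != v)) ==>
         [forall i in S u, forall j in S v, i < j]]].

Definition BSVT (a b : nat) :
    {set {ffun 'I_a * 'I_b -> {set 'I_(a * b).+2}}} :=
  [set S | is_bsvt S].

Definition ustar (a b : nat) (S : {ffun 'I_a * 'I_b -> {set 'I_(a * b).+2}}) :
    option ('I_a * 'I_b) :=
  [pick u | #|S u| == 2].

(* The default value 0 is never reached on BSVT a b. *)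
Definition istar (a b : nat) (S : {ffun 'I_a * 'I_b -> {set 'I_(a * b).+2}}) :
    nat :=
  if ustar S is Some u then \max_(i in S u) i else 0.

Definition next_higher (a b : nat)
    (S : {ffun 'I_a * 'I_b -> {set 'I_(a * b).+2}}) (i : nat) : bool :=
  [exists u : 'I_a * 'I_b, exists v : 'I_a * 'I_b,
     [&& [exists x in S u, x == i :> nat],
         [exists y in S v, y == i.+1 :> nat] & v.1 < u.1]].

Definition bsv_descent (a b : nat)
    (S : {ffun 'I_a * 'I_b -> {set 'I_(a * b).+2}}) (i : nat) : bool :=
  (i == istar S) || ((i.+1 != istar S) && next_higher S i).

Definition bsv_comaj (a b : nat)
    (S : {ffun 'I_a * 'I_b -> {set 'I_(a * b).+2}}) : nat :=
  \sum_(1 <= i < (a * b).+2 | bsv_descent S i) ((a * b).+1 - i).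

Local Open Scope ring_scope.

Definition qint (k : nat) : {poly int} := \sum_(i < k) 'X^i.

(* Main.v *)
(** Delete the larger entry [x] of the doubled box: a barely set-valued tableau
    becomes a word, i.e. a linear extension of the rectangle together with one
    free letter [x], and a box [p] which is a removable corner of the order
    ideal of the boxes read before [x].  The statistic comaj^{+1} is the usual
    comaj of that word, [x] carrying the largest label.

    By Stanley's theorem the generating function of comaj over the linear
    extensions of a poset depends only on which relations the labelling
    reverses.  Moving [x] from the largest to the smallest label raises comaj
    by one unless [x] is read first.  These two facts give, with [Z] the
    generating function of all words and [R_p], [A_p] those of the words for
    which [p] is removable, respectively addable, Z = [n+1]_q * F where [F] is
    the generating function of the standard tableaux, and A_p = q R_p.

    Finally, for g(r, c) = [a][b] - [a][c] - [b][r] every Young diagram in the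
    rectangle satisfies
      sum_(addable (r, c)) g(r, c) - sum_(removable (r, c)) g(r+1, c+1) = [a][b],
    and q g(r, c) - g(r+1, c+1) = [a+b], so [a+b] * sum_p R_p = [a][b] * Z. *)

Require Import Defs.
From mathcomp Require Import all_boot all_order all_algebra all_fingroup.
From mathcomp Require Import zify ring.
Import GRing.Theory.
Set Implicit Arguments.
Unset Strict Implicit.
Unset Printing Implicit Defensive.

(** * Words in labelled letters, and independence of the labelling *)

Section Words.
Variables (X : finType) (m : nat).
Implicit Types (s : {ffun X -> 'I_m}) (l : X -> nat) (Q : rel X).

(* [s u] is the position, counted from 0, of the letter [u]; the descent between
   positions [i.-1] and [i] is recorded as [i]. *)
Definition wdes l s (i : nat) : bool :=
  [exists u, exists v, [&& (s u).+1 == i, s v == i :> nat & l v < l u]].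

Definition wcomaj l s : nat := \sum_(1 <= i < m | wdes l s i) (m - i).

Definition linext Q s : bool :=
  injectiveb s && [forall y, forall z, Q y z ==> (s y < s z)].

Definition wswap u v s : {ffun X -> 'I_m} := [ffun y => s (tperm u v y)].

Lemma wdesP l s i :
  reflect (exists u v, [/\ (s u).+1 = i, s v = i :> nat & l v < l u])
          (wdes l s i).
Proof.
apply: (iffP existsP) => [[u /existsP[v /and3P[/eqP ? /eqP ? ?]]]|[u [v [su sv luv]]]].
  by exists u, v.
by exists u; apply/existsP; exists v; apply/and3P; split => //; apply/eqP.
Qed.

Lemma linextP Q s :
  reflect (injective s /\ forall y z, Q y z -> s y < s z) (linext Q s).
Proof.
apply: (iffP andP) => [[/injectiveP si /forallP sQ]|[si sQ]]; split => //.
- by move=> y z Qyz; have /forallP/(_ z)/implyP := sQ y; apply.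
- exact/injectiveP.
- by apply/forallP=> y; apply/forallP=> z; apply/implyP/sQ.
Qed.

Lemma wswapK u v : involutive (wswap u v).
Proof. by move=> s; apply/ffunP => y; rewrite !ffunE tpermK. Qed.

Lemma wcomaj_swap u v l s :
  wcomaj (l \o tperm u v) (wswap u v s) = wcomaj l s.
Proof.
apply: eq_bigl => i; apply/wdesP/wdesP => -[y [z]].
  by rewrite !ffunE /= => -[sy sz lyz]; exists (tperm u v y), (tperm u v z).
by case=> sy sz lyz; exists (tperm u v y), (tperm u v z); rewrite !ffunE /= !tpermK.
Qed.

Section AdjacentLabels.
Variables (l : X -> nat) (u v : X).
Hypotheses (l_inj : injective l) (luv : l u < l v)
  (l_adj : forall w, ~~ (l u < l w < l v)).

Lemma label_swap y z : (y, z) != (u, v) -> (y, z) != (v, u) ->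
  (l (tperm u v y) < l (tperm u v z)) = (l y < l z).
Proof.
have lI w w' : w <> w' -> l w <> l w' by move=> ww' /l_inj.
have := l_adj y; have := l_adj z.
case: tpermP => [->|->|/lI yu /lI yv]; case: tpermP => [->|->|/lI zu /lI zv];
  rewrite ?eqxx //; lia.
Qed.

(** Labels being adjacent, only the comparison of [u] with [v] changes, and it matters only when the
    two are read consecutively. *)
Lemma wcomaj_label_swap s : ~~ ((s u).+1 == s v) -> ~~ ((s v).+1 == s u) ->
  wcomaj (l \o tperm u v) s = wcomaj l s.
Proof.
move=> suv svu; apply: eq_bigl => i.
apply/wdesP/wdesP => -[y [z [sy sz]]] /=.
  move=> lyz; exists y, z; split=> //; rewrite -label_swap //;
    by apply/eqP => -[? ?]; subst y z; move: suv svu; rewrite sy sz eqxx.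
move=> lyz; exists y, z; split=> //; rewrite /= label_swap //;
  by apply/eqP => -[? ?]; subst y z; move: suv svu; rewrite sy sz eqxx.
Qed.

End AdjacentLabels.

(** No position lies between those of [u] and [v], so only their mutual order changes. *)
Lemma linext_swap Q u v s : ~~ Q u v -> ~~ Q v u ->
  ((s u).+1 == s v) || ((s v).+1 == s u) ->
  linext Q s -> linext Q (wswap u v s).
Proof.
move=> Quv Qvu adj /linextP[s_inj sQ]; apply/linextP; split.
  by move=> y z; rewrite !ffunE => /s_inj/perm_inj.
have sI w w' : w <> w' -> s w <> s w' :> nat by move=> ww' /val_inj/s_inj.
move=> y z Qyz; have := sQ _ _ Qyz; rewrite !ffunE.
move: Qyz; case: tpermP => [->|->|/sI yu /sI yv];
  case: tpermP => [->|->|/sI zu /sI zv] //; rewrite ?(negbTE Quv) ?(negbTE Qvu) //;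
  move=> _; lia.
Qed.

Local Open Scope ring_scope.

Definition wgen Q l : {poly int} := \sum_(s | linext Q s) 'X^(wcomaj l s).

(** Where [u] and [v] are consecutive, exchanging the letters along with their labels keeps comaj;
    elsewhere exchanging the labels alone does. *)
Lemma wgen_label_swap Q l u v : injective l -> (l u < l v)%N ->
  (forall w, ~~ (l u < l w < l v)%N) -> ~~ Q u v -> ~~ Q v u ->
  wgen Q (l \o tperm u v) = wgen Q l.
Proof.
move=> l_inj luv l_adj Quv Qvu.
pose adj s := ((s u).+1 == s v) || ((s v).+1 == s u).
have adj_swap s : adj (wswap u v s) = adj s.
  by rewrite /adj !ffunE tpermL tpermR orbC.
have ext_swap s : linext Q (wswap u v s) && adj (wswap u v s) = linext Q s && adj s.
  rewrite adj_swap; case: (boolP (adj s)) => [adjs|_]; rewrite ?andbF // !andbT.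
  apply/idP/idP; last exact: linext_swap.
  by move=> /(linext_swap Quv Qvu); rewrite wswapK; apply; rewrite -/(adj _) adj_swap.
rewrite /wgen (bigID adj) /= [RHS](bigID adj) /=; congr (_ + _); last first.
  by apply: eq_bigr => s /andP[_ /norP[? ?]]; rewrite wcomaj_label_swap.
rewrite (reindex_inj (inv_inj (wswapK u v))) /=.
by apply: eq_big => [s|s _]; rewrite ?ext_swap // wcomaj_swap.
Qed.

(* Stanley: only the strictness of the labelling along [Q] matters.  Two
   labellings agreeing on [Q] are joined by exchanges of adjacent labels of
   [Q]-unrelated elements, each decreasing the number of inversions. *)
Lemma wgen_label Q l l' : injective l -> injective l' ->
  (forall y z, Q y z -> (l y < l z)%N = (l' y < l' z)%N) ->
  wgen Q l = wgen Q l'.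
Proof.
pose inv l := [set yz : X * X | (l yz.1 < l yz.2)%N && (l' yz.2 < l' yz.1)%N].
have [k] := ubnP #|inv l|; elim: k l => // k IH l le_k l_inj l'_inj lQ.
case: (set_0Vmem (inv l)) => [inv0|[yz0 yz0_inv]].
  apply: eq_bigr => s _; congr ('X^_); apply: eq_bigl => i.
  have ltl y z : (l y < l z)%N = (l' y < l' z)%N.
    have := in_set0 (y, z); have := in_set0 (z, y); rewrite -inv0 !inE /=.
    have [->|yz] := eqVneq y z; first by rewrite !ltnn.
    have /eqP : l y != l z by rewrite (inj_eq l_inj).
    have /eqP : l' y != l' z by rewrite (inj_eq l'_inj).
    lia.
  by apply/wdesP/wdesP => -[y [z [sy sz]]] lzy; exists y, z;
    split=> //; rewrite ltl in lzy *.
(* An inverted pair at least [l]-distance has adjacent labels: a label in between would give a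
   closer inverted pair. *)
have [[u v]] := @arg_minnP _ yz0 (fun yz => yz \in inv l)
  (fun yz : X * X => l yz.2 - l yz.1)%N yz0_inv.
rewrite inE /= => /andP[luv l'vu] min_uv.
have l_adj w : ~~ (l u < l w < l v)%N.
  apply/negP => /andP[luw lwv].
  have [l'wu|l'uw] := ltnP (l' w) (l' u).
    by have := min_uv (u, w); rewrite inE /= luw l'wu => /(_ isT); lia.
  by have := min_uv (w, v); rewrite inE /= lwv (leq_trans l'vu l'uw) => /(_ isT); lia.
have Quv : ~~ Q u v by apply/negP => /lQ; rewrite luv; lia.
have Qvu : ~~ Q v u by apply/negP => /lQ; rewrite l'vu; lia.
rewrite -(wgen_label_swap l_inj luv l_adj Quv Qvu); apply: IH => //.
- rewrite (leq_trans _ (_ : #|inv l| <= k)%N) //.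
  apply/proper_card/properP; split.
    apply/subsetP => -[y z]; rewrite !inE /= => /andP[lt_yz lt_zy].
    rewrite lt_zy andbT.
    have [[e1 e2]|ne] := eqVneq (y, z) (u, v); first by rewrite e1 e2.
    have [[e1 e2]|ne'] := eqVneq (y, z) (v, u).
      by move: lt_zy; rewrite e1 e2; lia.
    by rewrite -(label_swap l_inj luv l_adj ne ne').
  by exists (u, v); rewrite !inE /= ?luv ?l'vu // tpermL tpermR; lia.
- exact: inj_comp l_inj perm_inj.
- move=> y z Qyz; rewrite /= (label_swap l_inj luv l_adj) ?lQ //.
    by apply: contraNneq Quv => -[<- <-].
  by apply: contraNneq Qvu => -[<- <-].
Qed.

End Words.

(** * Adding one letter to a labelled poset *)

Section ExtraLetter.
Variables (B : finType) (n M : nat) (lab : B -> nat).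
Hypotheses (cardB : #|B| = n) (lab_inj : injective lab)
  (lab_lt : forall y, lab y < M).
Implicit Types s : {ffun option B -> 'I_n.+1}.

(* [None] is the extra letter, labelled above or below all the others. *)
Definition ltop (y : option B) : nat := if y is Some z then lab z else M.
Definition lbot (y : option B) : nat := if y is Some z then (lab z).+1 else 0.

Lemma ltop_inj : injective ltop.
Proof.
move=> [y|] [z|] //= e; first by rewrite (lab_inj e).
  by have := lab_lt y; rewrite e ltnn.
by have := lab_lt z; rewrite -e ltnn.
Qed.

Lemma lbot_inj : injective lbot.
Proof. by move=> [y|] [z|] //= [/lab_inj ->]. Qed.

Lemma word_onto s i : injective s -> i < n.+1 -> exists y, s y = i :> nat.
Proof.
move=> s_inj lt_i.
have := inj_card_onto s_inj _ (Ordinal lt_i).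
rewrite card_ord card_option cardB => /(_ (leqnn _))/codomP[y e].
by exists y; rewrite -e.
Qed.

Definition box_des s (i : nat) : bool :=
  [exists u : B, exists v : B,
    [&& (s (Some u)).+1 == i, s (Some v) == i :> nat & lab v < lab u]].

Definition box_comaj s : nat := \sum_(1 <= i < n.+1 | box_des s i) (n.+1 - i).

Lemma box_desP s i :
  reflect (exists u v, [/\ (s (Some u)).+1 = i, s (Some v) = i :> nat & lab v < lab u])
          (box_des s i).
Proof.
apply: (iffP existsP) => [[u /existsP[v /and3P[/eqP ? /eqP ? ?]]]|[u [v [su sv luv]]]].
  by exists u, v.
by exists u; apply/existsP; exists v; apply/and3P; split => //; apply/eqP.
Qed.

(** One extra descent at [k]. The value [k = 0] (bottom label, read first) falls outside the sum,
    and [k = n.+1] (top label, read last) has weight 0. *)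
Lemma sum_descents_split (P P' : pred nat) k :
  (forall i, 1 <= i < n.+1 -> P i = P' i || (i == k)) -> ~~ P' k ->
  \sum_(1 <= i < n.+1 | P i) (n.+1 - i) =
    \sum_(1 <= i < n.+1 | P' i) (n.+1 - i) + (if 0 < k then n.+1 - k else 0).
Proof.
move=> PP' P'k.
have -> : (if 0 < k then n.+1 - k else 0) = \sum_(1 <= i < n.+1 | i == k) (n.+1 - i).
  by rewrite big_nat1_eq; case: (0 < k) => //=; case: ltnP => // /eqP.
rewrite big_mkcond [in RHS]big_mkcond [X in _ + X]big_mkcond -big_split /=.
rewrite !big_nat; apply: eq_bigr => i /PP' ->.
by have [->|] := eqVneq i k; rewrite ?(negbTE P'k) ?orbF ?addn0.
Qed.

(** The largest label makes a descent to the next letter, whatever it is. *)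
Lemma wcomaj_top s : injective s ->
  wcomaj ltop s = box_comaj s + (n - s None).
Proof.
move=> s_inj; rewrite -subSS.
apply: (@sum_descents_split _ _ (s None).+1) => [i /andP[i_gt0 lt_i]|].
  apply/wdesP/orP => [[[u|] [[v|] [su sv /= lvu]]]|[/box_desP[u [v [? ? ?]]]|/eqP ei]].
  - by left; apply/box_desP; exists u, v.
  - by have := lab_lt u; rewrite ltnNge ltnW.
  - by right; rewrite -su.
  - by rewrite ltnn in lvu.
  - by exists (Some u), (Some v).
  have [[v|] sv] := word_onto s_inj lt_i.
  - by exists None, (Some v); rewrite /= lab_lt.
  - by move: sv; lia.
apply/negP => /box_desP[u [v [[su]]]] _ _.
by have /s_inj := val_inj su.
Qed.

(** The smallest label makes a descent from the previous letter, if there is one. *)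
Lemma wcomaj_bot s : injective s ->
  wcomaj lbot s = box_comaj s + (if 0 < s None then n.+1 - s None else 0).
Proof.
move=> s_inj; apply: sum_descents_split => [i /andP[i_gt0 lt_i]|].
  apply/wdesP/orP => [[[u|] [[v|] [su sv /= lvu]]]|[/box_desP[u [v [? ? ?]]]|/eqP ei]] //.
  - by left; apply/box_desP; exists u, v.
  - by right; rewrite -sv.
  - by exists (Some u), (Some v).
  have lt_i1 : i.-1 < n.+1 by lia.
  have [[u|] su] := word_onto s_inj lt_i1.
  - by exists (Some u), None; rewrite /= su prednK.
  - by move: su; lia.
by apply/negP => /box_desP[u [v [_ /val_inj/s_inj]]].
Qed.

Lemma wcomaj_bot_gt0 s : injective s -> 0 < s None ->
  wcomaj lbot s = (wcomaj ltop s).+1.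
Proof.
move=> s_inj s_gt0; rewrite wcomaj_top // wcomaj_bot // s_gt0.
by have := ltn_ord (s None); lia.
Qed.


Variable P : rel B.
Hypotheses (P_irr : irreflexive P) (P_lab : forall y z, P y z -> lab y < lab z).

Definition Qfree (y z : option B) : bool :=
  if (y, z) is (Some y', Some z') then P y' z' else false.

(* [Qrem p] and [Qadd p] force the letters before [None] to form an ideal of
   which [p] is a maximal element, respectively a minimal non-element.  The
   relations of [p] that then follow by transitivity are left out: [wgen_label]
   only applies because they are not imposed. *)
Definition Qrem (p : B) (y z : option B) : bool :=
  match y, z with
  | Some y', Some z' => P y' z' && (y' != p)
  | Some y', None => y' == p
  | None, Some z' => P p z'
  | None, None => false
  end.

Definition Qadd (p : B) (y z : option B) : bool :=
  match y, z with
  | Some y', Some z' => P y' z' && (z' != p)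
  | Some y', None => P y' p
  | None, Some z' => z' == p
  | None, None => false
  end.

Definition removable p s : bool :=
  (s (Some p) < s None) && [forall z, P p z ==> (s None < s (Some z))].

Definition addable p s : bool :=
  (s None < s (Some p)) && [forall y, P y p ==> (s (Some y) < s None)].

Lemma removableP p s :
  reflect (s (Some p) < s None /\ forall z, P p z -> s None < s (Some z)) (removable p s).
Proof.
apply: (iffP andP) => -[sp H]; split=> //.
  by move=> z; move/forallP/(_ z)/implyP: H.
by apply/forallP => z; apply/implyP/H.
Qed.

Lemma addableP p s :
  reflect (s None < s (Some p) /\ forall y, P y p -> s (Some y) < s None) (addable p s).
Proof.
apply: (iffP andP) => -[sp H]; split=> //.
  by move=> z; move/forallP/(_ z)/implyP: H.
by apply/forallP => z; apply/implyP/H.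
Qed.

(** The relations [P p z] left out of [Qrem p] come back through the chain [p], [None], [z]. *)
Lemma linext_Qrem p s : linext (Qrem p) s = linext Qfree s && removable p s.
Proof.
apply/linextP/andP => [[s_inj sQ]|[/linextP[s_inj sQ] /removableP[sp sz]]].
  have sp : s (Some p) < s None by apply: sQ => /=.
  have sz z : P p z -> s None < s (Some z) by move=> Pz; apply: sQ.
  split; last exact/removableP.
  apply/linextP; split=> // -[y|] [z|] //= Pyz.
  have [e|yp] := eqVneq y p; last by apply: sQ; apply/andP.
  by subst y; apply: ltn_trans sp (sz _ Pyz).
split=> // -[y|] [z|] //=; last exact: sz.
  by case/andP => Pyz _; apply: sQ.
by move=> /eqP->.
Qed.

Lemma linext_Qadd p s : linext (Qadd p) s = linext Qfree s && addable p s.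
Proof.
apply/linextP/andP => [[s_inj sQ]|[/linextP[s_inj sQ] /addableP[sp sy]]].
  have sp : s None < s (Some p) by apply: sQ => /=.
  have sy y : P y p -> s (Some y) < s None by move=> Py; apply: sQ.
  split; last exact/addableP.
  apply/linextP; split=> // -[y|] [z|] //= Pyz.
  have [e|zp] := eqVneq z p; last by apply: sQ; apply/andP.
  by subst z; apply: ltn_trans (sy _ Pyz) sp.
split=> // -[y|] [z|] //=; last by move=> /eqP->.
  by case/andP => Pyz _; apply: sQ.
exact: sy.
Qed.

(** [None] sits just above [p] in [Qrem p] and just below it in [Qadd p], so the exchange matches
    the two. *)
Lemma Qadd_tperm p y z :
  Qadd p (tperm None (Some p) y) (tperm None (Some p) z) = Qrem p y z.
Proof.
have sE (y' : B) : Some y' <> Some p -> (y' == p) = false.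
  by move=> ne; apply/eqP => e; rewrite e in ne.
case: tpermP => [->|->|]; case: tpermP => [->|->|] /=; rewrite ?P_irr ?eqxx //.
- by case: z => [z|] //= _ zp; rewrite (sE _ zp) andbT.
- by case: z => [z|] //= _ zp; rewrite (sE _ zp) ?eqxx ?andbF.
- by case: y => [y|] //= _ yp; rewrite (sE _ yp) ?eqxx ?andbF.
- by case: y => [y|] //= _ yp; rewrite (sE _ yp) andbT.
- by case: z => [z|] //= _ zp; case: y => [y|] //= _ yp; rewrite (sE _ zp) (sE _ yp).
Qed.

Lemma linext_Qadd_swap p s :
  linext (Qadd p) (wswap None (Some p) s) = linext (Qrem p) s.
Proof.
apply/linextP/linextP => -[s_inj sQ]; split.
- move=> y z e; apply: (@perm_inj _ (tperm None (Some p))); apply: s_inj.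
  by rewrite !ffunE !tpermK.
- by move=> y z; rewrite -Qadd_tperm => /sQ; rewrite !ffunE !tpermK.
- by move=> y z; rewrite !ffunE => /s_inj/perm_inj.
- move=> y z; rewrite !ffunE -{1}(tpermK None (Some p) y) -{1}(tpermK None (Some p) z).
  by rewrite Qadd_tperm => /sQ.
Qed.

Local Open Scope ring_scope.

(* Exchanging [p] with the extra letter turns words where [p] is addable into
   words where it is removable; then the label of the extra letter may be
   moved to the bottom, and from there back to the top at the cost of one
   factor ['X]. *)
Lemma wgen_Qadd p : wgen n.+1 (Qadd p) ltop = 'X * wgen n.+1 (Qrem p) ltop.
Proof.
transitivity (wgen n.+1 (Qrem p) (ltop \o tperm None (Some p))).
  rewrite /wgen (reindex_inj (inv_inj (wswapK None (Some p)))) /=.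
  apply: eq_big => [s|s _]; first exact: linext_Qadd_swap.
  by rewrite -(wcomaj_swap None (Some p)) wswapK.
rewrite (@wgen_label _ _ _ _ lbot) //.
- rewrite /wgen big_distrr /=; apply: eq_bigr => s /linextP[s_inj sQ].
  rewrite wcomaj_bot_gt0 // ?exprS //.
  by apply: leq_ltn_trans (sQ (Some p) None _); rewrite /= ?eqxx.
- exact: inj_comp ltop_inj perm_inj.
- exact: lbot_inj.
(* Under both labellings the relation from [p] to [None] is the only one reversed. *)
have tO (y : B) : y != p -> tperm None (Some p) (Some y) = Some y.
  by move=> yp; rewrite tpermD //; apply: contra yp => /eqP[->].
move=> [y|] [z|] //=.
- case/andP => Pyz yp; rewrite (tO y yp) /= !ltnS (P_lab Pyz).
  by have [->|/tO->] := eqVneq z p; rewrite ?tpermR /= ?lab_lt ?P_lab.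
- by move=> /eqP ->; rewrite tpermL tpermR /= ltnNge ltnW.
- move=> Ppz; have zp : z != p by apply: contraTneq Ppz => ->; rewrite P_irr.
  by rewrite tpermL tO //= P_lab.
Qed.

(** With [None] read first, what remains is a linear extension of [P]: this is the series [F]. *)
Definition base_gen : {poly int} :=
  \sum_(s | linext Qfree s && (s None == 0%N :> nat)) 'X^(box_comaj s).

(** With [G] for [pos_gen], the top label gives Z = q^n F + G and the bottom label Z = F + q G;
    eliminate [G]. *)
Lemma wgen_Qfree :
  (1 - 'X) * wgen n.+1 Qfree ltop = (1 - 'X^(n.+1)) * base_gen.
Proof.
pose pos_gen : {poly int} :=
  \sum_(s : {ffun option B -> 'I_n.+1} | linext Qfree s && (s None != 0%N :> nat))
    'X^(wcomaj ltop s).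
have topE : wgen n.+1 Qfree ltop = 'X^n * base_gen + pos_gen.
  rewrite /wgen (bigID (fun s => s None == 0%N :> nat)) /=; congr (_ + _).
  rewrite big_distrr; apply: eq_bigr => s /andP[/linextP[s_inj _] /eqP s0].
  by rewrite wcomaj_top // s0 subn0 addnC exprD.
have botE : wgen n.+1 Qfree ltop = base_gen + 'X * pos_gen.
  rewrite (@wgen_label _ _ _ _ lbot); first 1 last.
  - exact: ltop_inj.
  - exact: lbot_inj.
  - by move=> [y|] [z|].
  rewrite /wgen (bigID (fun s => s None == 0%N :> nat)) /=; congr (_ + _).
    apply: eq_bigr => s /andP[/linextP[s_inj _] /eqP s0].
    by rewrite wcomaj_bot // s0 addn0.
  rewrite big_distrr; apply: eq_bigr => s /andP[/linextP[s_inj _] s0].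
  by rewrite wcomaj_bot_gt0 ?exprS // lt0n.
by rewrite mulrBl mul1r {1}botE topE exprS; ring.
Qed.

End ExtraLetter.

(** * q-integers and weighted corners of a Young diagram *)

Section QIntegers.
Local Open Scope ring_scope.

Lemma qint0 : qint 0 = 0.
Proof. by rewrite /qint big_ord0. Qed.

Lemma qintS k : qint k.+1 = 1 + 'X * qint k.
Proof.
rewrite /qint big_ord_recl expr0 big_distrr; congr (_ + _).
by apply: eq_bigr => i _; rewrite /= /bump add1n exprS.
Qed.

Lemma qint_geom k : (1 - 'X) * qint k = 1 - 'X^k.
Proof.
elim: k => [|k IH]; first by rewrite qint0 mulr0 expr0 subrr.
by rewrite qintS mulrDr mulrCA IH exprS; ring.
Qed.

(** This is [j] + q^j [k] with q^j = 1 + (q - 1)[j], so that no power of q remains. *)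
Lemma qintD j k : qint (j + k) = qint j + qint k + ('X - 1) * qint j * qint k.
Proof.
elim: j => [|j IH]; first by rewrite qint0 add0n; ring.
by rewrite addSn !qintS IH; ring.
Qed.

Lemma qint_neq0 k : (0 < k)%N -> qint k != 0.
Proof.
case: k => // k _; apply/eqP => /(congr1 (fun p : {poly int} => p.[0])).
by rewrite qintS !hornerE.
Qed.

(** The function g; it vanishes at (0, b) and (a, 0), the two ends of the boundary path of a
    diagram. *)
Definition cweight (a b r c : nat) : {poly int} :=
  qint a * qint b - qint a * qint c - qint b * qint r.

Lemma cweight_step a b r c :
  'X * cweight a b r c - cweight a b r.+1 c.+1 = qint (a + b).
Proof. by rewrite /cweight !qintS qintD; ring. Qed.

(* [mu r.+1] is the length of row [r] of a Young diagram in the a x b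
   rectangle, so the two conditions say that the box (r, c) is an outer,
   respectively inner, corner. *)
Lemma corner_identity a b (mu : nat -> nat) :
  mu 0 = b -> mu a.+1 = 0%N -> (forall r, mu r.+1 <= mu r)%N ->
  \sum_(r < a) \sum_(c < b)
    (cweight a b r c *+ ((mu r.+1 == c) && (c < mu r)%N) -
     cweight a b r.+1 c.+1 *+ ((mu r.+1 == c.+1) && (mu r.+2 <= c)%N))
  = qint a * qint b.
Proof.
move=> mu0 muS mu_dec.
have mu_le r : (mu r <= b)%N by elim: r => [|r IH]; rewrite ?mu0 // (leq_trans (mu_dec r)).
pose g := cweight a b.
(* A row has at most one outer corner, just past its end. *)
have outer r : \sum_(c < b) g r c *+ ((mu r.+1 == c) && (c < mu r)%N) =
    g r (mu r.+1) *+ (mu r.+1 < mu r)%N.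
  have [lt_mu|ge_mu] := ltnP (mu r.+1) (mu r); last first.
    by rewrite big1 // => c _; have [<-|] := eqVneq; rewrite // ltnNge ge_mu.
  have lt_b := leq_trans lt_mu (mu_le r).
  rewrite (bigD1 (Ordinal lt_b)) //= eqxx lt_mu big1 ?addr0 // => c.
  by rewrite -val_eqE /= eq_sym => /negbTE->.
(* The inner corner is the last box of the row; the shift of both indices puts its weight at (r + 1,
   mu (r + 1)). *)
have inner r : \sum_(c < b) g r.+1 c.+1 *+ ((mu r.+1 == c.+1) && (mu r.+2 <= c)%N) =
    g r.+1 (mu r.+1) *+ (mu r.+2 < mu r.+1)%N.
  have [lt_mu|ge_mu] := ltnP (mu r.+2) (mu r.+1); last first.
    by rewrite big1 // => c _; have [e|] := eqVneq; rewrite //= -ltnS -e ltnNge ge_mu.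
  have lt_b : ((mu r.+1).-1 < b)%N by have := mu_le r.+1; lia.
  rewrite (bigD1 (Ordinal lt_b)) //= prednK; last by lia.
  rewrite eqxx (_ : mu r.+2 <= _)%N; last by lia.
  rewrite big1 ?addr0 // => c; rewrite -val_eqE /= => ne.
  by rewrite (_ : (mu r.+1 == c.+1) = false) //; lia.
under eq_bigr => r _ do rewrite sumrB outer inner.
pose f r := g r (mu r.+1) *+ (mu r.+1 < mu r)%N.
pose h r := g r (mu r) *+ (mu r.+1 < mu r)%N.
(* The added terms [f a] and [h 0] vanish, being weights at (a, 0) and (0, b). *)
have -> : \sum_(r < a) (f r - h r.+1) = \sum_(r < a.+1) (f r - h r).
  rewrite !sumrB [X in _ = X - _]big_ord_recr [X in _ = _ - X]big_ord_recl /=.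
  have fa : f a = 0 by rewrite /f muS /g /cweight qint0 mulr0 subr0 mulrC subrr mul0rn.
  have h0 : h 0%N = 0 by rewrite /h mu0 /g /cweight qint0 mulr0 subr0 subrr mul0rn.
  by rewrite fa h0 addr0 add0r.
(* Both weights now lie in row [r], so their row terms cancel; equal lengths give 0 on both
   sides. *)
under eq_bigr => r _.
  have -> : f r - h r = qint a * (qint (mu r) - qint (mu r.+1)).
    rewrite /f /h -mulrnBl /g /cweight.
    have := mu_dec r; rewrite leq_eqVlt => /orP[/eqP->|->].
      by rewrite ltnn mulr0n subrr mulr0.
    by rewrite mulr1n; ring.
  over.
rewrite -big_distrr /=; congr (_ * _).
rewrite -(big_mkord xpredT (fun r => qint (mu r) - qint (mu r.+1))).
rewrite -[LHS]opprK -sumrN; under eq_bigr do rewrite opprB.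
by rewrite telescope_sumr // muS mu0 qint0 sub0r opprK.
Qed.

End QIntegers.

(** * The rectangle as a poset, and the diagrams cut out by words *)

Section Rectangle.
Variables a b : nat.
Notation box := ('I_a * 'I_b)%type.
Notation word := {ffun option box -> 'I_(a * b).+1}.
Implicit Types (s : word) (y z p : box).

Definition nw y z : bool := weakly_nw y z && (y != z).
Definition lab y : nat := y.1 * b + y.2.

Lemma nwE y z : nw y z = [&& y.1 <= z.1, y.2 <= z.2 & (y.1 < z.1) || (y.2 < z.2)].
Proof.
by case: y z => [y1 y2] [z1 z2]; rewrite /nw /weakly_nw xpair_eqE -!val_eqE /=; lia.
Qed.

Lemma nw_irr : irreflexive nw.
Proof. by move=> y; rewrite nwE !ltnn !andbF. Qed.

Lemma card_box : #|{: box}| = a * b.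
Proof. by rewrite card_prod !card_ord. Qed.

Lemma lab_row y z : y.1 < z.1 -> lab y < lab z.
Proof.
move=> lt; rewrite /lab; apply: (@leq_trans (y.1.+1 * b)).
  by rewrite mulSn addnC ltn_add2r.
by rewrite (leq_trans _ (leq_addr _ _)) // leq_mul2r lt orbT.
Qed.

Lemma lab_inj : injective lab.
Proof.
move=> [y1 y2] [z1 z2] e.
have e1 : y1 = z1.
  apply/val_inj; case: (ltngtP y1 z1) => // lt.
    by have := @lab_row (y1, y2) (z1, z2) lt; rewrite e ltnn.
  by have := @lab_row (z1, z2) (y1, y2) lt; rewrite e ltnn.
subst z1; congr (_, _); apply/val_inj.
by move: e; rewrite /lab /= => /addnI.
Qed.

Lemma lab_lt y : lab y < a * b.
Proof.
rewrite /lab; apply: (@leq_trans (y.1.+1 * b)).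
  by rewrite mulSn addnC ltn_add2r.
by rewrite leq_mul2r ltn_ord orbT.
Qed.

Lemma nw_lab y z : nw y z -> lab y < lab z.
Proof.
rewrite nwE leq_eqVlt => /and3P[/orP[/eqP e|/lab_row //] _].
by rewrite /lab e ltnn ltn_add2l.
Qed.

Notation free := (linext (Qfree nw)).

(** Within one row the smaller label lies to the left and must be read earlier, so a descent can
    only go to a higher row. *)
Lemma free_row s u v : free s -> s (Some v) = (s (Some u)).+1 :> nat ->
  (lab v < lab u) = (v.1 < u.1).
Proof.
move=> /linextP[s_inj sQ] svu; apply/idP/idP => [lvu|/lab_row //].
rewrite ltnNge leq_eqVlt; apply/negP => /orP[/eqP e|lt]; last first.
  by have := ltn_trans lvu (lab_row lt); rewrite ltnn.
have : nw v u.
  by rewrite nwE e leqnn; move: lvu; rewrite /lab e ltn_add2l => lt; rewrite lt ltnW ?orbT.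
by move=> /(sQ (Some v) (Some u)); rewrite svu ltnNge leqnSn.
Qed.

(** The boxes read before [None] form an order ideal, hence a Young diagram; [mu 0 = b] stands for a
    full row above the rectangle. *)
Lemma free_shape s : free s -> exists mu : nat -> nat,
  [/\ mu 0 = b, mu a.+1 = 0, forall r, mu r.+1 <= mu r
    & forall y, (s (Some y) < s None) = (y.2 < mu y.1.+1)].
Proof.
move=> /linextP[s_inj sQ].
pose I r c := [exists y : box, [&& y.1 == r :> nat, y.2 == c :> nat & s (Some y) < s None]].
have IP r c : reflect
    (exists y : box, [/\ y.1 = r :> nat, y.2 = c :> nat & s (Some y) < s None])
    (I r c).
  apply: (iffP existsP) => [[y /and3P[/eqP ? /eqP ? ?]]|[y [? ? ?]]]; exists y => //.
  by apply/and3P; split => //; apply/eqP.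
have I_le r r' c c' : r' <= r -> c' <= c -> I r c -> I r' c'.
  move=> ler lec /IP[y [e1 e2 ys]].
  have lt1 : r' < a by have := ltn_ord y.1; lia.
  have lt2 : c' < b by have := ltn_ord y.2; lia.
  apply/IP; exists (Ordinal lt1, Ordinal lt2); split=> //.
  have [->|ne] := eqVneq (Ordinal lt1, Ordinal lt2) y => //.
  apply: ltn_trans ys; apply: sQ.
  by rewrite /Qfree /nw ne andbT /weakly_nw /= e1 e2 ler lec.
have I_out r : exists c, ~~ I r c.
  exists b; apply/negP => /IP[y [_ e _]].
  by have := ltn_ord y.2; rewrite e ltnn.
pose lam r := ex_minn (I_out r).
have lamP r c : I r c = (c < lam r).
  rewrite /lam; case: ex_minnP => k nIk min_k; apply/idP/idP => [Ic|lt_c].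
    by rewrite ltnNge; apply: contra nIk => le_k; apply: I_le Ic.
  by apply: contraLR lt_c => /min_k; rewrite -leqNgt.
have lam_le r k : ~~ I r k -> lam r <= k by rewrite lamP -leqNgt.
exists (fun r => if r is r'.+1 then lam r' else b); split=> //.
- apply/eqP; rewrite -leqn0; apply: lam_le; apply/negP => /IP[y [e _ _]].
  by have := ltn_ord y.1; rewrite e ltnn.
- case=> [|r]; apply: lam_le; apply/negP.
    by move=> /IP[y [_ e _]]; have := ltn_ord y.2; rewrite e ltnn.
  by move=> /(I_le _ _ _ _ (leqnSn r) (leqnn _)); rewrite lamP ltnn.
- move=> y; rewrite -lamP; apply/idP/IP => [ys|[z [e1 e2 zs]]]; first by exists y.
  suff -> : y = z by [].
  by case: y z e1 e2 {zs} => [y1 y2] [z1 z2] /= /val_inj-> /val_inj->.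
Qed.

(** Only the left and upper neighbours need testing; in the top row [mu 0 = b] replaces the upper
    one. *)
Lemma addable_corner s (mu : nat -> nat) (r : 'I_a) (c : 'I_b) : free s ->
  mu 0 = b -> (forall r, mu r.+1 <= mu r) ->
  (forall y, (s (Some y) < s None) = (y.2 < mu y.1.+1)) ->
  addable nw (r, c) s = (mu r.+1 == c) && (c < mu r).
Proof.
move=> /linextP[s_inj sQ] mu0 mu_dec muP.
have mu_anti i j : i <= j -> mu j <= mu i.
  by elim: j => [|j IH]; rewrite leq_eqVlt => /orP[/eqP->|] // /IH; apply/leq_trans/mu_dec.
have outP y : (s None < s (Some y)) = (mu y.1.+1 <= y.2).
  by rewrite ltn_neqAle leqNgt muP -leqNgt; case: eqP => // /val_inj/s_inj.
apply/addableP/andP => [[sp sy]|[/eqP muc lt_c]]; last first.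
  split; first by rewrite outP /= muc.
  move=> y; rewrite muP nwE /= => /and3P[le1 le2 /orP[lt1|lt2]].
    by have := mu_anti _ _ lt1; lia.
  by rewrite (leq_trans _ (mu_anti _ r.+1 _)) ?muc.
have le_c : mu r.+1 <= c by rewrite -(outP (r, c)).
split.
  rewrite eqn_leq le_c /=; case: (posnP c) => [->//|c_gt0].
  have lt : c.-1 < b by have := ltn_ord c; lia.
  by have := sy (r, Ordinal lt); rewrite muP nwE /=; lia.
case: (posnP r) => [->|r_gt0]; first by rewrite mu0.
have lt : r.-1 < a by have := ltn_ord r; lia.
by have := sy (Ordinal lt, c); rewrite muP nwE /= prednK //; lia.
Qed.

(** Dually with the right and lower neighbours; below the bottom row, [mu a.+1 = 0]. *)
Lemma removable_corner s (mu : nat -> nat) (r : 'I_a) (c : 'I_b) : free s ->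
  mu 0 = b -> mu a.+1 = 0 -> (forall r, mu r.+1 <= mu r) ->
  (forall y, (s (Some y) < s None) = (y.2 < mu y.1.+1)) ->
  removable nw (r, c) s = (mu r.+1 == c.+1) && (mu r.+2 <= c).
Proof.
move=> /linextP[s_inj sQ] mu0 muS mu_dec muP.
have mu_anti i j : i <= j -> mu j <= mu i.
  by elim: j => [|j IH]; rewrite leq_eqVlt => /orP[/eqP->|] // /IH; apply/leq_trans/mu_dec.
have outP y : (s None < s (Some y)) = (mu y.1.+1 <= y.2).
  by rewrite ltn_neqAle leqNgt muP -leqNgt; case: eqP => // /val_inj/s_inj.
apply/removableP/andP => [[]|[/eqP muc le_c]]; last first.
  split; first by rewrite muP /= muc.
  move=> y; rewrite nwE /= => /and3P[le1 le2 lt].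
  rewrite outP; case/orP: lt => [lt1|lt2].
    by rewrite (leq_trans (mu_anti r.+2 _ _)) // (leq_trans le_c).
  by rewrite (leq_trans (mu_anti r.+1 _ _)) ?muc.
rewrite muP /= => lt_c sz; split.
  rewrite eqn_leq lt_c andbT leqNgt; apply/negP => lt_c1.
  have lt : c.+1 < b by have := mu_anti 0 r.+1 isT; rewrite mu0; lia.
  by have := sz (r, Ordinal lt); rewrite outP nwE /=; lia.
have [lt|ge] := ltnP r.+1 a.
  by have := sz (Ordinal lt, c); rewrite outP nwE /=; lia.
have -> : r.+2 = a.+1 by have := ltn_ord r; lia.
by rewrite muS.
Qed.

Local Open Scope ring_scope.

Notation ltop := (ltop (a * b) lab).

Lemma removable_expectation :
  qint (a + b) * \sum_p wgen (a * b).+1 (Qrem nw p) ltop =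
  qint a * qint b * wgen (a * b).+1 (Qfree nw) ltop.
Proof.
(* Exchanging the sums over boxes and words reduces the claim to the corner identity for each
   word. *)
have split_gen Q (t : box -> word -> bool) (w : box -> {poly int}) :
    (forall p s, linext (Q p) s = free s && t p s) ->
    \sum_p w p * wgen (a * b).+1 (Q p) ltop =
    \sum_(s | free s) (\sum_p w p *+ t p s) * 'X^(wcomaj ltop s).
  move=> QE; under [RHS]eq_bigr do rewrite big_distrl /=.
  rewrite [RHS]exchange_big /=; apply: eq_bigr => p _.
  rewrite /wgen big_distrr /= (eq_bigl _ _ (QE p)) big_mkcondr /=.
  by apply: eq_bigr => s _; case: (t p s); rewrite ?mulr1n ?mulr0n ?mul0r.
pose g (p : box) := cweight a b p.1 p.2.
pose g' (p : box) := cweight a b p.1.+1 p.2.+1.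
transitivity (\sum_p g p * wgen (a * b).+1 (Qadd nw p) ltop
             - \sum_p g' p * wgen (a * b).+1 (Qrem nw p) ltop).
  rewrite big_distrr -sumrB /=; apply: eq_bigr => p _.
  rewrite (wgen_Qadd card_box lab_inj lab_lt nw_irr nw_lab).
  by rewrite -(cweight_step a b p.1 p.2) /g /g'; ring.
rewrite (split_gen _ _ _ (linext_Qadd nw)) (split_gen _ _ _ (linext_Qrem nw)).
rewrite -sumrB /wgen big_distrr; apply: eq_bigr => s fs.
rewrite -mulrBl -sumrB; congr (_ * _).
have [mu [mu0 muS mu_dec muP]] := free_shape fs.
rewrite -(corner_identity mu0 muS mu_dec) pair_bigA /=.
apply: eq_bigr => -[r c] _.
by rewrite (addable_corner r c fs mu0 mu_dec muP) (removable_corner r c fs mu0 muS mu_dec muP).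
Qed.

Lemma free_gen :
  wgen (a * b).+1 (Qfree nw) ltop = qint (a * b + 1) * base_gen (a * b) lab nw.
Proof.
have X1 : 1 - 'X != 0 :> {poly int}.
  by rewrite subr_eq0 eq_sym; apply/eqP => /(congr1 (fun p : {poly int} => p.[0]));
    rewrite !hornerE.
apply: (mulfI X1).
by rewrite (wgen_Qfree card_box lab_inj lab_lt) mulrA qint_geom addn1.
Qed.


(** * Standard tableaux as words *)

(** With [None] at position 0, the 1-based entries are the positions of the boxes. *)
Definition syt_word (T : {ffun box -> 'I_(a * b).+1}) : word :=
  [ffun y => if y is Some y' then T y' else ord0].

Lemma is_syt_word T :
  is_syt T = free (syt_word T) && (syt_word T None == 0%N :> nat).
Proof.
rewrite [syt_word T None]ffunE eqxx andbT.
have wS y : syt_word T (Some y) = T y by rewrite ffunE.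
have w0 : syt_word T None = ord0 by rewrite ffunE.
apply/and4P/linextP.
  case=> /forallP T_gt0 /injectiveP T_inj /forallP rowT /forallP colT.
  have row r (c c' : 'I_b) : (c < c')%N -> (T (r, c) < T (r, c'))%N.
    by have /forallP/(_ c)/forallP/(_ c')/implyP := rowT r; apply.
  have col (r r' : 'I_a) c : (r < r')%N -> (T (r, c) < T (r', c))%N.
    by have /forallP/(_ r')/forallP/(_ c)/implyP := colT r; apply.
  split.
    move=> [y|] [z|] //; rewrite ?wS ?w0; first by move=> /T_inj->.
      by move=> e; have := T_gt0 y; rewrite e.
    by move=> e; have := T_gt0 z; rewrite -e.
  move=> [[y1 y2]|] [[z1 z2]|] //; rewrite !wS /Qfree nwE /= => /and3P[].
  rewrite leq_eqVlt => /orP[/eqP/val_inj<- _|lt1]; first by rewrite ltnn => /row.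
  rewrite leq_eqVlt => /orP[/eqP/val_inj<- _|lt2 _]; first exact: col.
  (* Through the box in the row of the second and the column of the first. *)
  exact: ltn_trans (col _ _ _ lt1) (row _ _ _ lt2).
case=> s_inj sQ.
have T_nw y z : nw y z -> (T y < T z)%N.
  by move=> /(sQ (Some y) (Some z)); rewrite !wS.
have T_inj : injective T.
  by move=> y z e; have [] : Some y = Some z by apply: s_inj; rewrite !wS.
split.
- apply/forallP => y; rewrite lt0n; apply/eqP => e.
  by have /s_inj : syt_word T (Some y) = syt_word T None by apply/val_inj; rewrite wS w0.
- exact/injectiveP.
- apply/forallP => r; apply/forallP => c; apply/forallP => c'; apply/implyP => lt.
  by apply: T_nw; rewrite nwE /= leqnn lt ltnW // orbT.
- apply/forallP => r; apply/forallP => r'; apply/forallP => c; apply/implyP => lt.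
  by apply: T_nw; rewrite nwE /= leqnn lt ltnW.
Qed.

Lemma comaj_word T : is_syt T -> comaj T = box_comaj lab (syt_word T).
Proof.
move=> sytT; have /and4P[/forallP T_gt0 _ _ _] := sytT.
have fs : free (syt_word T) by have := sytT; rewrite is_syt_word => /andP[].
have wS y : syt_word T (Some y) = T y by rewrite ffunE.
rewrite /comaj /box_comaj; have [n0|n_gt0] := posnP (a * b).
  by rewrite !big_geq // n0.
rewrite big_mkcond [in RHS]big_mkcond /= [RHS]big_ltn //=.
(* Position 0 belongs to [None], so no box descent is recorded at 1; dropping this term shifts the
   index by one. *)
have -> : box_des lab (syt_word T) 1 = false.
  by apply/box_desP => -[u [v [+ _ _]]]; rewrite wS => -[]; have := T_gt0 u; lia.
rewrite [RHS]add0n [RHS]big_add1 /=; apply: eq_bigr => i _; rewrite subSS.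
suff -> : descent T i = box_des lab (syt_word T) i.+1 by [].
apply/existsP/box_desP => [[u /existsP[v /and3P[/eqP Tu /eqP Tv lt]]]|[u [v [su sv lt]]]].
  exists u, v; rewrite !wS Tu Tv; split=> //.
  by rewrite (free_row fs) // !wS Tu Tv.
exists u; apply/existsP; exists v.
have svu : syt_word T (Some v) = (syt_word T (Some u)).+1 :> nat by rewrite su sv.
by rewrite -(free_row fs svu) lt -!wS sv -eqSS su !eqxx.
Qed.

Lemma syt_gen : \sum_(T in SYT a b) 'X^(comaj T) = base_gen (a * b) lab nw.
Proof.
pose tab (s : word) : {ffun box -> 'I_(a * b).+1} := [ffun y => s (Some y)].
rewrite /base_gen (reindex_onto syt_word tab) /=; last first.
  move=> s /andP[_ /eqP s0]; apply/ffunP => -[y|]; rewrite !ffunE //.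
  exact/val_inj.
apply: eq_big => [T|T]; rewrite inE; last by move=> /comaj_word->.
have -> : tab (syt_word T) = T by apply/ffunP => y; rewrite !ffunE.
by rewrite is_syt_word eqxx andbT.
Qed.

(** * Barely set-valued tableaux as words *)

Definition bsvt_of (p : box) (s : word) : {ffun box -> {set 'I_(a * b).+2}} :=
  [ffun y => [set i : 'I_(a * b).+2 | (i == (s (Some y)).+1 :> nat) ||
                                  (y == p) && (i == (s None).+1 :> nat)]].

Section DoubledBox.
Variable p : box.

Lemma in_bsvt_of s y (i : 'I_(a * b).+2) : (i \in bsvt_of p s y) =
  (i == (s (Some y)).+1 :> nat) || (y == p) && (i == (s None).+1 :> nat).
Proof. by rewrite ffunE inE. Qed.

Lemma bsvt_of_neq s y : y != p ->
  bsvt_of p s y = [set lift ord0 (s (Some y))].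
Proof.
by move=> /negbTE yp; apply/setP => i; rewrite in_bsvt_of yp orbF inE -val_eqE.
Qed.

Lemma bsvt_of_eq s :
  bsvt_of p s p = [set lift ord0 (s (Some p)); lift ord0 (s None)].
Proof. by apply/setP => i; rewrite in_bsvt_of eqxx !inE -!val_eqE. Qed.

Lemma card_bsvt_of s y : injective s -> #|bsvt_of p s y| = (y == p).+1.
Proof.
move=> s_inj; have [->|yp] := eqVneq y p; last by rewrite bsvt_of_neq ?cards1.
rewrite bsvt_of_eq cards2; case: eqP => // /lift_inj/s_inj //.
Qed.

(** The set at [p] is unordered, but [Qrem p] reads [p] before [None], which tells its two entries
    apart. *)
Lemma bsvt_of_inj : {in [set s | linext (Qrem nw p) s] &, injective (bsvt_of p)}.
Proof.
move=> s t; rewrite !inE => /linextP[s_inj sQ] /linextP[t_inj tQ] e.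
have lt_s : (s (Some p) < s None)%N by apply: sQ => /=.
have lt_t : (t (Some p) < t None)%N by apply: tQ => /=.
have ep i := congr1 (fun S : {ffun box -> {set 'I_(a * b).+2}} => i \in S p) e.
have := ep (lift ord0 (s (Some p))); have := ep (lift ord0 (s None)).
have := ep (lift ord0 (t (Some p))); have := ep (lift ord0 (t None)).
rewrite !in_bsvt_of !lift0 !eqSS !eqxx !orbT !andTb !orTb.
have key (x x' y y' : nat) : (x < x')%N -> (y < y')%N ->
    ((y' == x) || (y' == x')) = true -> ((y == x) || (y == x')) = true ->
    true = ((x' == y) || (x' == y')) -> true = ((x == y) || (x == y')) ->
    x' = y' /\ x = y by lia.
move=> e1 e2 e3 e4; have [eN eP] := key _ _ _ _ lt_s lt_t e1 e2 e3 e4.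
apply/ffunP => -[y|]; last exact/val_inj.
have [->|yp] := eqVneq y p; first exact/val_inj.
have := congr1 (fun S : {ffun box -> {set 'I_(a * b).+2}} => S y) e.
by rewrite !bsvt_of_neq // => /set1_inj/lift_inj.
Qed.

Lemma bsvt_of_bsvt s : linext (Qrem nw p) s -> bsvt_of p s \in BSVT a b.
Proof.
move=> /linextP[s_inj sQ].
have lt_s : (s (Some p) < s None)%N by apply: sQ => /=.
have sI (y z : option box) : y != z -> s y != s z :> nat.
  by apply: contra => /eqP/val_inj/s_inj->.
rewrite inE; apply/and5P; split.
- by apply/forallP => y; rewrite -card_gt0 card_bsvt_of.
- apply/forallP => u; apply/forallP => v; apply/implyP => uv.
  rewrite disjoints_subset; apply/subsetP => i; rewrite inE !in_bsvt_of.
  have uv' : Some u != Some v by [].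
  have := sI _ _ uv'; have := sI (Some u) None isT; have := sI (Some v) None isT.
  by have := uv; case: (eqVneq u p) => [->|_]; case: (eqVneq v p) => [->|_];
    rewrite ?eqxx //= => _; lia.
- apply/eqP/setP => i; rewrite inE; apply/bigcupP/idP => [[u _]|i_gt0].
    by rewrite in_bsvt_of; lia.
  have lt_i : (i.-1 < (a * b).+1)%N by have := ltn_ord i; lia.
  have [[y|] sy] := word_onto card_box s_inj lt_i.
    by exists y => //; rewrite in_bsvt_of sy prednK ?eqxx.
  by exists p => //; rewrite in_bsvt_of sy prednK ?eqxx ?orbT.
- apply/existsP; exists p; rewrite card_bsvt_of // eqxx /=.
  by apply/forallP => v; apply/implyP => /negbTE vp; rewrite card_bsvt_of // vp.
- apply/forallP => u; apply/forallP => v; apply/implyP => uv.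
  apply/forallP => i; apply/implyP => iu; apply/forallP => j; apply/implyP => jv.
  have nuv : nw u v by [].
  move: iu jv; rewrite !in_bsvt_of.
  have [eu|up] /= := eqVneq u p.
    have vp : v != p by apply: contraTneq nuv => ->; rewrite eu nw_irr.
    have : (s None < s (Some v))%N by apply: sQ; rewrite /= -eu.
    rewrite (negbTE vp) orbF eu => lt_v /orP[/eqP->|/eqP->] /eqP->; rewrite ltnS //.
    exact: ltn_trans lt_s lt_v.
  have : (s (Some u) < s (Some v))%N by apply: sQ; rewrite /= nuv.
  rewrite orbF => lt_uv /eqP->; case/orP => [/eqP->|/andP[/eqP vp /eqP->]] //.
  by rewrite ltnS (ltn_trans lt_uv) // vp.
Qed.

Lemma bsvt_of_onto (S : {ffun box -> {set 'I_(a * b).+2}}) :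
  S \in BSVT a b -> #|S p| == 2 ->
  exists2 s, linext (Qrem nw p) s & S = bsvt_of p s.
Proof.
rewrite inE => /and5P[_ /forallP S_dis /eqP S_cov].
move=> /existsP[p' /andP[_ /forallP S_1]] /forallP S_lt Sp.
have S1 y : y != p -> #|S y| = 1%N.
  have <- : p' = p.
    apply/eqP; apply: contraLR Sp => pp'; rewrite eq_sym in pp'.
    by have /implyP/(_ pp')/eqP-> := S_1 p.
  by move=> yp; have /implyP/(_ yp)/eqP := S_1 y.
have [e0 [m [lt_em Spe]]] : exists e0 m : 'I_(a * b).+2, (e0 < m)%N /\ S p = [set e0; m].
  have /cards2P[x [y [xy ->]]] := Sp.
  have [lt|lt|/val_inj e] := ltngtP x y; [by exists x, y|by exists y, x; rewrite setUC|].
  by rewrite e eqxx in xy.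
have [e eP] : exists e : box -> 'I_(a * b).+2,
    forall y, S y = if y == p then [set e0; m] else [set e y].
  apply: (@fin_all_exists _ (fun=> 'I_(a * b).+2)
    (fun y x => S y = if y == p then [set e0; m] else [set x])) => y.
  (* At [p] the value of [e] is a dummy. *)
  have [->|yp] := eqVneq y p; first by exists m.
  by have /eqP/cards1P[x ->] := S1 y yp; exists x.
pose f (y : option box) := if y is Some y' then (if y' == p then e0 else e y') else m.
(* With the extra letter placed in [p], each relation of [Qrem p] comes from [nw] between boxes,
   except that from [p] to [None], which is [e0 < m]. *)
pose own (y : option box) := if y is Some y' then y' else p.
have f_own (y : option box) : f y \in S (own y).
  by case: y => [y|] /=; rewrite ?Spe ?eP; [case: eqP|]; rewrite !inE ?eqxx ?orbT.
have f_gt0 (y : option box) : (0 < f y)%N.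
  have : f y \in \bigcup_u S u by apply/bigcupP; exists (own y).
  by rewrite S_cov inE.
have S_own y z i : i \in S y -> i \in S z -> y = z.
  move=> iy iz; apply/eqP; apply: contraT => yz.
  have /forallP/(_ z)/implyP/(_ yz) := S_dis y.
  by move=> /disjointFr/(_ iy); rewrite iz.
have f_inj : injective f.
  move=> y z fyz; have : own y = own z by apply: (S_own _ _ (f y)); rewrite // fyz.
  case: y z fyz => [y|] [z|] //=; first by move=> _ ->.
    by move=> + yp; rewrite yp eqxx => e'; move: lt_em; rewrite e' ltnn.
  by move=> + zp; rewrite -zp eqxx => e'; move: lt_em; rewrite e' ltnn.
have f_nw (y z : option box) : nw (own y) (own z) -> (f y < f z)%N.
  move=> yz; have /forallP/(_ (own z))/implyP/(_ yz) := S_lt (own y).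
  by move=> /forallP/(_ (f y))/implyP/(_ (f_own y))/forallP/(_ (f z))/implyP/(_ (f_own z)).
pose s : word := [ffun y => inord (f y).-1].
have sE (y : option box) : (s y).+1 = f y.
  by rewrite ffunE inordK ?prednK //; have := ltn_ord (f y); have := f_gt0 y; lia.
exists s.
  apply/linextP; split.
    by move=> y z syz; apply/f_inj/val_inj; rewrite /= -!sE syz.
  move=> [y|] [z|] //=; rewrite -ltnS !sE => H.
  - by apply: f_nw; case/andP: H.
  - by rewrite /f H.
  - by apply: f_nw.
apply/ffunP => y; apply/setP => i; rewrite in_bsvt_of !sE eP /=.
by have [_|_] := eqVneq y p; rewrite !inE ?orbF -!val_eqE.
Qed.

Lemma istar_bsvt_of s : linext (Qrem nw p) s -> istar (bsvt_of p s) = (s None).+1.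
Proof.
move=> /linextP[s_inj sQ].
have lt_s : (s (Some p) < s None)%N by apply: sQ => /=.
rewrite /istar /ustar; case: pickP => [u|/(_ p)]; last by rewrite card_bsvt_of // eqxx.
rewrite card_bsvt_of //; have [->|//] := eqVneq u p => _.
rewrite bsvt_of_eq big_setU1; last first.
  by rewrite inE (inj_eq lift_inj); apply/eqP => e; rewrite e ltnn in lt_s.
by rewrite big_set1 !lift0; apply/maxn_idPr; rewrite ltnS ltnW.
Qed.

(** With the largest label on [None], the word always descends after it and never into it: these are
    the two exceptions at [i_*] and [i_* - 1]. *)
Lemma bsv_comaj_bsvt_of s : linext (Qrem nw p) s ->
  bsv_comaj (bsvt_of p s) = wcomaj ltop s.
Proof.
move=> ext_s; have := ext_s; rewrite linext_Qrem => /andP[fs _].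
have /linextP[s_inj sQ] := ext_s.
(* The number ab + 1 has weight 0, so the sum may stop before it. *)
rewrite /bsv_comaj big_mkcond big_nat_recr //= subnn if_same addn0 -big_mkcond /=.
rewrite /wcomaj big_nat_cond [RHS]big_nat_cond; apply: eq_bigl => i.
have [/andP[i_gt0 lt_i]|//] := boolP (1 <= i < (a * b).+1)%N; rewrite !andTb.
rewrite /bsv_descent istar_bsvt_of // eqSS.
have inP (u : box) (k : nat) : reflect ((s (Some u)).+1 = k \/ (u = p /\ (s None).+1 = k))
    [exists x in bsvt_of p s u, x == k :> nat].
  apply: (iffP existsP) => [[x /andP[+ /eqP<-]]|H].
    rewrite in_bsvt_of => /orP[/eqP->|/andP[/eqP-> /eqP->]]; by [left|right].
  have lt_k : (k < (a * b).+2)%N by case: H => [<-|[_ <-]]; rewrite ltnS.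
  exists (Ordinal lt_k); rewrite in_bsvt_of /= eqxx andbT.
  by case: H => [<-|[-> <-]]; rewrite !eqxx ?orbT.
apply/orP/wdesP => [[/eqP ei|/andP[ix]]|]; first 1 last.
- move=> /existsP[u /existsP[v /and3P[/inP iu /inP iv lt]]].
  have sv : s (Some v) = i :> nat.
    by case: iv => [[]//|[_ [ei]]]; rewrite ei eqxx in ix.
  case: iu => [iu|[_ iu]].
    by exists (Some u), (Some v); split=> //=; rewrite lab_row.
  by exists None, (Some v); rewrite /= lab_lt.
- case=> [[u|]] [[v|]] [su sv /= lt]; last by rewrite ltnn in lt.
  + right; apply/andP; split.
      by apply/eqP => ei; have /s_inj : s (Some v) = s None by apply/val_inj; rewrite /= sv ei.
    apply/existsP; exists u; apply/existsP; exists v.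
    rewrite -(free_row fs) ?sv ?su // lt andbT; apply/andP; split; apply/inP; left => //.
    by rewrite sv.
  + by have := ltn_trans lt (lab_lt u); rewrite ltnn.
  + by left; rewrite -su.
- have [[v|] sv] := word_onto card_box s_inj lt_i; last by move: sv; rewrite ei => /n_Sn.
  by exists None, (Some v); rewrite /= lab_lt ei sv.
Qed.

Lemma bsvt_gen_box :
  \sum_(S in BSVT a b | #|S p| == 2) 'X^(bsv_comaj S) = wgen (a * b).+1 (Qrem nw p) ltop.
Proof.
have imE : [set S in BSVT a b | #|S p| == 2] = bsvt_of p @: [set s | linext (Qrem nw p) s].
  apply/setP => S; rewrite inE; apply/andP/imsetP => [[SB Sp]|[s + ->]].
    by have [s ext_s ->] := bsvt_of_onto SB Sp; exists s; rewrite // inE.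
  rewrite inE => ext_s; split; first exact: bsvt_of_bsvt.
  by have /linextP[s_inj _] := ext_s; rewrite card_bsvt_of // eqxx.
rewrite -big_set imE big_imset; last exact: bsvt_of_inj.
by apply: eq_big => [s|s]; rewrite inE // => /bsv_comaj_bsvt_of->.
Qed.

End DoubledBox.

(** Each tableau has exactly one doubled box, so it is counted for exactly one [p]. *)
Lemma bsvt_gen :
  \sum_(S in BSVT a b) 'X^(bsv_comaj S) = \sum_p wgen (a * b).+1 (Qrem nw p) ltop.
Proof.
under [RHS]eq_bigr do rewrite -bsvt_gen_box.
rewrite [RHS](exchange_big_dep (fun S => S \in BSVT a b)) /=; last by move=> p S _ /andP[].
apply: eq_bigr => S; rewrite inE => SB; have /and5P[_ _ _ + _] := SB.
move=> /existsP[u /andP[Su /forallP S1]].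
rewrite (eq_bigl (pred1 u)) ?big_pred1_eq // => v; rewrite /= SB.
have [->|vu] := eqVneq v u; first by rewrite Su.
by have /implyP/(_ vu)/eqP-> := S1 v.
Qed.

End Rectangle.

Local Open Scope ring_scope.

Theorem theorem1p1 (a b : nat) (ha : (1 <= a)%N) (hb : (1 <= b)%N) :
  (tofrac (\sum_(S in BSVT a b) 'X^(bsv_comaj S)) : {fraction {poly int}}) =
  tofrac (qint a) * tofrac (qint b) / tofrac (qint (a + b)) *
    tofrac (qint (a * b + 1)) *
    tofrac (\sum_(T in SYT a b) 'X^(comaj T)).
Proof.
(* The denominator is nonzero as a + b > 0, and can be cleared. *)
have q0 : tofrac (qint (a + b)) != 0.
  by rewrite tofrac_eq0 qint_neq0 // addn_gt0 ha.
apply: (mulfI q0).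
rewrite -[LHS]tofracM bsvt_gen removable_expectation free_gen syt_gen.
have cancelq (F : fieldType) (q x y z w : F) : q != 0 ->
    x * y * (z * w) = q * (x * y / q * z * w) by move=> ?; field.
by rewrite -cancelq // !tofracM.
Qed.
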